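(* Let $K_1,K_2\subset\mathbb{R}^2$ be finite sets (of pixels), and let the underlying distance-function be the Euclidean distance $\delta(i,j,x,y)=\sqrt{(i-x)^2+(j-y)^2}$. Let $\{\alpha(i,j):(i,j)\in K_1\}$, $\{\beta(x,y):(x,y)\in K_2\}$ be a feasible set of dual variables such that each pixel in $K_1$ and each pixel in $K_2$ belongs to an admissible arc. Let $(i_0,j_0)\in K_1$. Let $(x_1,y_1)\in K_2$ be NE of $(i_0,j_0)$, different from $(i_0,j_0)$, and not an admissible pixel with respect to $(i_0,j_0)$. Let $(i_1,j_1)\in K_1$ be an admissible pixel with respect to $(x_1,y_1)$, and assume that $(i_1,j_1)$ is also NE of $(i_0,j_0)$ ($i_1$ not necessarily larger than $i_0$). Put $$r=\delta(i_0,j_0,x_1,y_1)-\alpha(i_0,j_0)-\beta(x_1,y_1),\qquad a=\tfrac12\,\delta(i_0,j_0,i_1,j_1),$$ let $s$ be a real number with $0\le s<r$, and put $$b=\delta(i_0,j_0,x_1,y_1)-\delta(i_1,j_1,x_1,y_1)-r+s.$$ (a) Suppose $b\le 0$ and $j_1>j_0$, and define $$y_2=\frac{j_0+j_1}{2}+\frac{(i_1-i_0)^2}{2(j_1-j_0)}.$$ Then, if $y>y_2$, $NE[i_0,y]\cap K_2\subset L[(i_0,j_0),K_2,s]$. (b) Suppose $b>0$, $j_1>j_0$, $i_1>i_0$ and $j_1-j_0\le i_1-i_0$. If $$\sqrt{(4a^2-b^2)/b^2}\ \ge\ \frac{i_1-i_0}{j_1-j_0},$$ then $NE[x_1,y_1]\cap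 K_2\subset L[(i_0,j_0),K_2,s]$. (c) Suppose $b>0$, $j_1>j_0$, $i_1>i_0$ and $j_1-j_0>i_1-i_0$. If $$\sqrt{(4a^2-b^2)/b^2}\ \ge\ \frac{j_1-j_0}{i_1-i_0},$$ then $NE[x_1,y_1]\cap K_2\subset L[(i_0,j_0),K_2,s]$, and also $NE[i_0,y]\cap K_2\subset L[(i_0,j_0),K_2,s]$ for every $y\ge y_3$, where $$y_3=j_1+\frac{2(i_1-i_0)^2(j_1-j_0)}{(j_1-j_0)^2-(i_1-i_0)^2}.$$
   Context: Dual variables are real numbers $\alpha(i,j)$, $(i,j)\in K_1$, and $\beta(x,y)$, $(x,y)\in K_2$. They are feasible if $\delta(i,j,x,y)-\alpha(i,j)-\beta(x,y)\ge 0$ for all $(i,j)\in K_1$, $(x,y)\in K_2$. A pair $\{(i,j),(x,y)\}$ with $(i,j)\in K_1$, $(x,y)\in K_2$ is an arc; it is admissible if $\alpha(i,j)+\beta(x,y)=\delta(i,j,x,y)$, and in that case $(x,y)$ is called an admissible pixel with respect to $(i,j)$ and vice versa. A point $(x',y')$ is NE (northeast) of a point $(x,y)$ if $x\le x'$ and $y\le y'$. $NE[i,j]=\{(x,y)\in\mathbb{R}^2:x\ge i,\ y\ge j\}$. Level set: for $(i,j)\in K_1$ and $t\ge 0$, $L[(i,j),K_2,t]=\{(x,y)\in K_2:\delta(i,j,x,y)-\alpha(i,j)-\beta(x,y)>t\}$. *)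

(* Defs.v *)
From mathcomp Require Import all_boot all_order all_algebra.
From mathcomp Require Import boolp classical_sets cardinality reals.

Set Implicit Arguments.
Unset Strict Implicit.
Unset Printing Implicit Defensive.

Import Order.TTheory GRing.Theory Num.Theory.
Local Open Scope classical_set_scope.
Local Open Scope ring_scope.

(** Points of the plane are pairs of reals.  The dual variables [alpha] and
    [beta] are total functions on the plane, but only their values on [K1] and
    [K2] respectively are ever used.  The distance-function [d] is a parameter
    of the notions attached to the dual variables. *)

Definition euclid (R : realType) (p q : R * R) : R :=
  Num.sqrt ((p.1 - q.1) ^+ 2 + (p.2 - q.2) ^+ 2).

Definition feasible (R : realType) (d : R * R -> R * R -> R)
    (K1 K2 : set (R * R)) (alpha beta : R * R -> R) : Prop :=
  forall p q, K1 p -> K2 q -> 0 <= d p q - alpha p - beta q.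

(** The pixel of [K1] always comes first. *)
Definition admissible (R : realType) (d : R * R -> R * R -> R)
    (K1 K2 : set (R * R)) (alpha beta : R * R -> R) (p q : R * R) : Prop :=
  [/\ K1 p, K2 q & alpha p + beta q = d p q].

(** [northeast p' p]: the first argument is the one lying NE of the other. *)
Definition northeast (R : realType) (p' p : R * R) : Prop :=
  p.1 <= p'.1 /\ p.2 <= p'.2.

Definition NE (R : realType) (i j : R) : set (R * R) :=
  [set p | i <= p.1 /\ j <= p.2].

Definition level_set (R : realType) (d : R * R -> R * R -> R)
    (alpha beta : R * R -> R) (p : R * R) (K2 : set (R * R)) (t : R) :
    set (R * R) :=
  [set q | K2 q /\ t < d p q - alpha p - beta q].

(* Main.v *)
(** Complementary slackness along the admissible arc [(i1, j1), (x1, y1)] and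
    feasibility of [(i1, j1), q] bound the slack of [(i0, j0), q] from below by
    [|p0 - q| - |p1 - q| + s - b], with [p0 = (i0, j0)] and [p1 = (i1, j1)].  So
    it suffices that [q] lies in the region [|p0 - q| - |p1 - q| > b] bounded by
    a branch of a hyperbola with foci [p0], [p1].  For [b <= 0] the region contains
    the half-plane of points nearer to [p1] than to [p0], which gives (a).  Since
    [s < r], it always contains [(x1, y1)].  The hypothesis on the slope of the
    asymptote amounts to [b <= j1 - j0] in (b) and to [b <= i1 - i0] in (c).
    In both cases [b] is at most each coordinate of [p1 - p0], and then the region
    is closed under moving northeast.  In (c) it also contains [(i0, y3)]. *)

Require Import Defs.
From mathcomp Require Import all_boot all_order all_algebra.
From mathcomp Require Import boolp classical_sets cardinality reals.
From mathcomp Require Import ring lra.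

Set Implicit Arguments.
Unset Strict Implicit.
Unset Printing Implicit Defensive.

Import Order.TTheory GRing.Theory Num.Theory.
Local Open Scope classical_set_scope.
Local Open Scope ring_scope.

Section Euclid.
Variable R : realType.
Implicit Types p q : R * R.

Lemma euclid_ge0 p q : 0 <= euclid p q.
Proof. exact: sqrtr_ge0. Qed.

Lemma sqr_euclid p q :
  euclid p q ^+ 2 = (p.1 - q.1) ^+ 2 + (p.2 - q.2) ^+ 2.
Proof. by rewrite sqr_sqrtr // addr_ge0 ?sqr_ge0. Qed.

Lemma dist1_le_euclid p q : `|p.1 - q.1| <= euclid p q.
Proof.
rewrite -ler_sqr ?nnegrE ?normr_ge0 ?euclid_ge0 // real_normK ?num_real //.
by rewrite sqr_euclid lerDl sqr_ge0.
Qed.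

Lemma dist2_le_euclid p q : `|p.2 - q.2| <= euclid p q.
Proof.
rewrite -ler_sqr ?nnegrE ?normr_ge0 ?euclid_ge0 // real_normK ?num_real //.
by rewrite sqr_euclid lerDr sqr_ge0.
Qed.

(** Triangle inequality, with the length of the step from [q] to [q'] bounded by its horizontal plus
    its vertical part. The squares of the two sides differ by exactly twice the sum of the products
    [m1], [m2], [m3]. *)
Lemma euclid_northeast p q q' : northeast q' q ->
  euclid p q' <= euclid p q + (q'.1 - q.1) + (q'.2 - q.2).
Proof.
move=> [le1 le2]; have A0 := euclid_ge0 p q; have sqA := sqr_euclid p q.
have := dist1_le_euclid p q; rewrite ler_norml => /andP[d1 _].
have := dist2_le_euclid p q; rewrite ler_norml => /andP[d2 _].
rewrite -ler_sqr ?nnegrE ?euclid_ge0 //; last by lra.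
rewrite sqr_euclid.
have m1 : 0 <= (q'.1 - q.1) * (euclid p q + (p.1 - q.1)) by apply: mulr_ge0; lra.
have m2 : 0 <= (q'.2 - q.2) * (euclid p q + (p.2 - q.2)) by apply: mulr_ge0; lra.
have m3 : 0 <= (q'.1 - q.1) * (q'.2 - q.2) by apply: mulr_ge0; lra.
nra.
Qed.

Lemma hyperbola_region_sqr p0 p1 q b : 0 <= b ->
  (b < euclid p0 q - euclid p1 q) = ((euclid p1 q + b) ^+ 2 < euclid p0 q ^+ 2).
Proof.
move=> b0; rewrite ltr_sqr ?nnegrE ?addr_ge0 ?euclid_ge0 //.
by rewrite ltrBrDl.
Qed.

(** After squaring, the condition reads |p0 - q|^2 - |p1 - q|^2 > 2 b |p1 - q| + b^2. The left side
    is affine in [q] with gradient 2 (p1 - p0), so a step (h, k) northeast raises it by at least 2 b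
    (h + k). The right side grows by at most that much, by [euclid_northeast]. *)
Lemma hyperbola_region_northeast p0 p1 q q' b : 0 <= b ->
  b <= p1.1 - p0.1 -> b <= p1.2 - p0.2 -> northeast q' q ->
  b < euclid p0 q - euclid p1 q -> b < euclid p0 q' - euclid p1 q'.
Proof.
move=> b0 bu bv ne; rewrite !hyperbola_region_sqr // => lt_q.
have := euclid_northeast p1 ne; have [le1 le2] := ne => tri.
move: lt_q; rewrite !sqrrD !sqr_euclid => lt_q.
have m1 : 0 <= (q'.1 - q.1) * (p1.1 - p0.1 - b) by apply: mulr_ge0; lra.
have m2 : 0 <= (q'.2 - q.2) * (p1.2 - p0.2 - b) by apply: mulr_ge0; lra.
have m3 : 0 <= b * (euclid p1 q + (q'.1 - q.1) + (q'.2 - q.2) - euclid p1 q').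
  by apply: mulr_ge0; lra.
nra.
Qed.

Lemma le_of_asymptote_slope (u v b : R) : 0 < b -> 0 < u -> 0 < v ->
  u / v <= Num.sqrt ((u ^+ 2 + v ^+ 2 - b ^+ 2) / b ^+ 2) -> b <= v.
Proof.
move=> b0 u0 v0 le_sqrt.
have uv0 : 0 < u / v by rewrite divr_gt0.
(* [Num.sqrt] is 0 on negative numbers, so a positive lower bound forces a positive radicand. *)
have := lt_le_trans uv0 le_sqrt; rewrite sqrtr_gt0 => /ltW rad0.
have : (u / v) ^+ 2 <= (u ^+ 2 + v ^+ 2 - b ^+ 2) / b ^+ 2.
  by rewrite -(sqr_sqrtr rad0) ler_sqr ?nnegrE ?sqrtr_ge0 ?(ltW uv0).
rewrite expr_div_n ler_pdivrMr ?exprn_gt0 // mulrAC ler_pdivlMr ?exprn_gt0 //.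
move=> le_uv; rewrite -ler_sqr ?nnegrE ?(ltW b0) ?(ltW v0) //.
have D0 : 0 < u ^+ 2 + v ^+ 2 by rewrite addr_gt0 ?exprn_gt0.
(* Clearing denominators gave u^2 b^2 <= (u^2 + v^2 - b^2) v^2, that is, (u^2 + v^2) b^2 <= (u^2 +
   v^2) v^2. *)
rewrite -(ler_pM2l D0); nra.
Qed.

(** The bound on [q.2] is the height at which the perpendicular bisector of [p0] and [p1] meets the
    vertical line through [p0]. To the right of that line the bisector does not rise. *)
Lemma lt_euclid_bisector p0 p1 q : p0.1 <= p1.1 -> p0.2 < p1.2 -> p0.1 <= q.1 ->
  (p0.2 + p1.2) / 2 + (p1.1 - p0.1) ^+ 2 / (2 * (p1.2 - p0.2)) < q.2 ->
  euclid p1 q < euclid p0 q.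
Proof.
move=> le1 lt2 leq1 ltq2; rewrite -ltr_sqr ?nnegrE ?euclid_ge0 // !sqr_euclid.
have v0 : 0 < 2 * (p1.2 - p0.2) by lra.
move: ltq2; rewrite -ltrBrDl ltr_pdivrMr // => ltq2.
have m : 0 <= (p1.1 - p0.1) * (q.1 - p0.1) by apply: mulr_ge0; lra.
nra.
Qed.

Lemma hyperbola_region_column p0 p1 y : p0.1 < p1.1 ->
  p1.1 - p0.1 < p1.2 - p0.2 ->
  y = p1.2 + 2 * (p1.1 - p0.1) ^+ 2 * (p1.2 - p0.2) /
              ((p1.2 - p0.2) ^+ 2 - (p1.1 - p0.1) ^+ 2) ->
  p1.1 - p0.1 < euclid p0 (p0.1, y) - euclid p1 (p0.1, y).
Proof.
set u := p1.1 - p0.1; set v := p1.2 - p0.2 => lt1 ltuv def_y.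
have u0 : 0 < u by rewrite /u; lra.
have v0 : 0 < v by apply: lt_trans ltuv.
have w0 : 0 < v ^+ 2 - u ^+ 2 by nra.
pose z := y - p1.2.
have def_z : z * (v ^+ 2 - u ^+ 2) = 2 * u ^+ 2 * v.
  by rewrite /z def_y addrC addKr divfK ?gt_eqF.
have z0 : 0 < z by rewrite -(pmulr_lgt0 _ w0) def_z !mulr_gt0 ?exprn_gt0.
have e0 : euclid p0 (p0.1, y) = v + z.
  rewrite /euclid /= subrr expr0n add0r sqrtr_sqr.
  have -> : p0.2 - y = - (v + z) by rewrite /v /z; ring.
  by rewrite normrN gtr0_norm //; lra.
have e1 : euclid p1 (p0.1, y) ^+ 2 = u ^+ 2 + z ^+ 2.
  by rewrite sqr_euclid /= /u /z; ring.
suff : euclid p1 (p0.1, y) < v + z - u by rewrite e0; lra.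
rewrite -ltr_sqr ?nnegrE ?euclid_ge0 //; last by lra.
rewrite e1.
(* The first factor is (v + z - u)^2 - (u^2 + z^2). Multiplied by u + v, it contains [z] only
   through z (v^2 - u^2), which [def_z] evaluates. *)
have k : 0 < (v ^+ 2 - 2 * u * v + 2 * z * (v - u)) * (u + v).
  have -> : (v ^+ 2 - 2 * u * v + 2 * z * (v - u)) * (u + v) =
    v * ((v - u) ^+ 2 + u * v + u ^+ 2).
    transitivity ((v ^+ 2 - 2 * u * v) * (u + v) + 2 * (z * (v ^+ 2 - u ^+ 2))).
      by ring.
    by rewrite def_z; ring.
  by apply: mulr_gt0; nra.
by move: k; rewrite pmulr_lgt0 => [k|]; nra.
Qed.

End Euclid.

Lemma level_set_of_euclid_diff (R : realType) (K1 K2 : set (R * R))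
    (alpha beta : R * R -> R) (p0 p1 q1 q : R * R) (s : R) :
  feasible (@euclid R) K1 K2 alpha beta ->
  admissible (@euclid R) K1 K2 alpha beta p1 q1 -> K2 q ->
  euclid p0 q1 - euclid p1 q1 - (euclid p0 q1 - alpha p0 - beta q1) + s <
    euclid p0 q - euclid p1 q ->
  level_set (@euclid R) alpha beta p0 K2 s q.
Proof.
move=> feas [K1p1 _ adm] K2q lt_b; split=> //.
by have := feas _ _ K1p1 K2q; lra.
Qed.

Theorem theorem6 (R : realType) (K1 K2 : set (R * R))
    (finK1 : finite_set K1) (finK2 : finite_set K2)
    (alpha beta : R * R -> R)
    (feas : feasible (@euclid R) K1 K2 alpha beta)
    (adm1 : forall p, K1 p ->
       exists q, admissible (@euclid R) K1 K2 alpha beta p q)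
    (adm2 : forall q, K2 q ->
       exists p, admissible (@euclid R) K1 K2 alpha beta p q)
    (i0 j0 : R) (K1_0 : K1 (i0, j0))
    (x1 y1 : R) (K2_1 : K2 (x1, y1))
    (NE_1 : northeast (x1, y1) (i0, j0))
    (neq_1 : (x1, y1) <> (i0, j0))
    (nadm_1 : ~ admissible (@euclid R) K1 K2 alpha beta (i0, j0) (x1, y1))
    (i1 j1 : R) (K1_1 : K1 (i1, j1))
    (adm_1 : admissible (@euclid R) K1 K2 alpha beta (i1, j1) (x1, y1))
    (NE_i1 : northeast (i1, j1) (i0, j0))
    (r : R)
    (def_r : r = euclid (i0, j0) (x1, y1) - alpha (i0, j0) - beta (x1, y1))
    (a : R) (def_a : a = 2^-1 * euclid (i0, j0) (i1, j1))
    (s : R) (s_ge0 : 0 <= s) (s_lt_r : s < r)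
    (b : R)
    (def_b : b = euclid (i0, j0) (x1, y1) - euclid (i1, j1) (x1, y1) - r + s) :
  [/\ (* (a) *)
      b <= 0 -> j0 < j1 ->
        forall y2 : R, y2 = (j0 + j1) / 2 + (i1 - i0) ^+ 2 / (2 * (j1 - j0)) ->
        forall y : R, y2 < y ->
        NE i0 y `&` K2 `<=` level_set (@euclid R) alpha beta (i0, j0) K2 s,
      (* (b) *)
      0 < b -> j0 < j1 -> i0 < i1 -> j1 - j0 <= i1 - i0 ->
        (i1 - i0) / (j1 - j0) <= Num.sqrt ((4 * a ^+ 2 - b ^+ 2) / b ^+ 2) ->
        NE x1 y1 `&` K2 `<=` level_set (@euclid R) alpha beta (i0, j0) K2 s
    & (* (c) *)
      0 < b -> j0 < j1 -> i0 < i1 -> i1 - i0 < j1 - j0 ->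
        (j1 - j0) / (i1 - i0) <= Num.sqrt ((4 * a ^+ 2 - b ^+ 2) / b ^+ 2) ->
        NE x1 y1 `&` K2 `<=` level_set (@euclid R) alpha beta (i0, j0) K2 s /\
        (forall y3 : R, y3 = j1 + 2 * (i1 - i0) ^+ 2 * (j1 - j0) /
                              ((j1 - j0) ^+ 2 - (i1 - i0) ^+ 2) ->
         forall y : R, y3 <= y ->
         NE i0 y `&` K2 `<=` level_set (@euclid R) alpha beta (i0, j0) K2 s)].
Proof.
have in_level q : K2 q -> b < euclid (i0, j0) q - euclid (i1, j1) q ->
    level_set (@euclid R) alpha beta (i0, j0) K2 s q.
  move=> K2q lt_b; apply: level_set_of_euclid_diff feas adm_1 K2q _.
  by rewrite -def_r -def_b.
(* The difference of distances is b + r - s. *)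
have lt_b1 : b < euclid (i0, j0) (x1, y1) - euclid (i1, j1) (x1, y1) by lra.
have def_4a2 : 4 * a ^+ 2 = (i1 - i0) ^+ 2 + (j1 - j0) ^+ 2.
  have := sqr_euclid (i0, j0) (i1, j1); rewrite def_a /= => sqrE.
  by rewrite exprMn sqrE; field.
have [/= le_i _] := NE_i1.
split.
- move=> b_le0 lt_j y2 def_y2 y lt_y q [[/= le_q1 le_q2] K2q].
  apply: in_level => //; apply: le_lt_trans b_le0 _; rewrite subr_gt0.
  by apply: lt_euclid_bisector => //=; rewrite -def_y2; apply: lt_le_trans le_q2.
- move=> b_gt0 lt_j lt_i le_ji le_sqrt q [NEq K2q].
  have le_bj : b <= j1 - j0.
    by apply: (@le_of_asymptote_slope _ (i1 - i0)); rewrite ?subr_gt0 // -def_4a2.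
  apply: in_level => //; apply: hyperbola_region_northeast lt_b1 => //=; lra.
- move=> b_gt0 lt_j lt_i lt_ij le_sqrt.
  have le_bi : b <= i1 - i0.
    (* The two coordinates exchange roles compared with (b). *)
    apply: (@le_of_asymptote_slope _ (j1 - j0)); rewrite ?subr_gt0 //.
    by rewrite [_ ^+ 2 + _]addrC -def_4a2.
  have le_bj : b <= j1 - j0 by lra.
  split=> [q [NEq K2q] | y3 def_y3 y le_y q [[/= le_q1 le_q2] K2q]].
    apply: in_level => //.
    by apply: hyperbola_region_northeast lt_b1 => //; apply: ltW.
  apply: in_level => //.
  have NEq : northeast q (i0, y3) by split=> //=; apply: le_trans le_q2.
  apply: (hyperbola_region_northeast (ltW b_gt0) _ _ NEq) => //.
  (* The point (i0, y3) lies even in the smaller region with i1 - i0 in place of [b]. *)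
  apply: le_lt_trans le_bi _.
  exact: (@hyperbola_region_column _ (i0, j0) (i1, j1)).
Qed.
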